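(* Let $N\ge1$, let $p,q$ be distinct primes not dividing $N$, and let $r,s$ be positive integers. Then for every $f\in\mathcal{M}(N)$, $f|\mathcal{T}(p^{r})\mathcal{T}(q^{s})=f|\mathcal{T}(q^{s})\mathcal{T}(p^{r})$.
   Context: Let $e(\tau)=e^{2\pi i\tau}$ denote the local parameter at $i\infty$. $\mathcal{M}(N)$ denotes the multiplicative group of meromorphic modular forms $f$ on the upper half-plane of some integer weight $k$ for $\Gamma_0(N)$ with some unitary multiplier system (i.e. $f(\gamma\tau)=\chi(\gamma)(c\tau+d)^kf(\tau)$ for $\gamma\in\Gamma_0(N)$, $\chi:\Gamma_0(N)\to S^1$, meromorphic at cusps), with integer Fourier coefficients at $i\infty$ and leading coefficient $1$. With $(f|_k\gamma)(\tau)=\det(\gamma)^{k/2}(c\tau+d)^{-k}f(\gamma\tau)$, for a prime $\ell\nmid N$, $r\ge1$ and $f\in\mathcal{M}(N)$ of weight $k$: $f|\mathcal{T}(\ell^{r}):=\varepsilon\, \ell^{\frac{k}{1-\ell}\left(\frac{\ell^{r+1}-\ell}{\ell-1}-\frac{r}{2}(\ell^{r+1}+1)\right)}\prod_{ad=\ell^{r},\,0\le b<d}f|_{k}\begin{psmallmatrix}a&b\\0&d\end{psmallmatrix}$ ($a,d>0$), with $\varepsilon$ the constant making the leading coefficient 1; it lies in $\mathcal{M}(N)$ with weight $k\sigma(\ell^r)$. $f|\mathcal{T}(a)\mathcal{T}(b)$ means $(f|\mathcal{T}(a))|\mathcal{T}(b)$, each operator using the weight of its argument. *)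

(* Defs.v *)
From HB Require Import structures.
From mathcomp Require Import all_boot all_order all_algebra.
From mathcomp Require Import complex.
From mathcomp Require Import all_classical all_reals all_analysis.

Set Implicit Arguments.
Unset Strict Implicit.
Unset Printing Implicit Defensive.

Import Order.TTheory GRing.Theory Num.Theory.
Import numFieldNormedType.Exports.

Local Open Scope classical_set_scope.
Local Open Scope complex_scope.
Local Open Scope ring_scope.

(* The norm topology on R[i]; the library only provides it for R[i]^o. *)
Section ComplexNormedModule.
Variable R : realType.

#[non_forgetful_inheritance]
HB.instance Definition _ := PseudoPointedMetric.copy R[i] R[i]^o.
#[non_forgetful_inheritance]
HB.instance Definition _ := GRing.ComAlgebra.copy R[i] R[i]^o.
#[non_forgetful_inheritance]
HB.instance Definition _ := Vector.copy R[i] R[i]^o.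
#[non_forgetful_inheritance]
HB.instance Definition _ := NormedModule.copy R[i] R[i]^o.

End ComplexNormedModule.

(* Meromorphic functions on an open U are represented by total functions
   R[i] -> R[i] whose values at poles (and at any other point of a discrete
   closed subset of U) are irrelevant; [mero_eq U] is equality of meromorphic
   functions on U. *)

Section MeromorphicFunctions.
Variable R : realType.
Implicit Types (U : set R[i]) (f g : R[i] -> R[i]).

(* e(z) = exp(2 pi i z) *)
Definition e (z : R[i]) : R[i] :=
  (expR (- (2 * pi * complex.Im z)))%:C
  * (cos (2 * pi * complex.Re z) +i* sin (2 * pi * complex.Re z)).

Definition Im_gt (Y : R) : set R[i] := [set z | Y < complex.Im z].

Definition upper_half_plane : set R[i] := Im_gt 0.

Definition mero_eq U f g : Prop :=
  forall z, U z -> \forall t \near z^', f t = g t.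

Definition holomorphic_near (z : R[i]) g : Prop :=
  \forall t \near z, derivable g t 1.

Definition meromorphic U f : Prop :=
  forall z, U z -> exists (n : nat) (g : R[i] -> R[i]),
    holomorphic_near z g /\
    \forall t \near z^', f t = (t - z) ^- n * g t.

(* f(t) = e(h t) * \sum_(n >= 0) a_n e(n t / w) for Im t large; since h is an
   arbitrary real number, it absorbs both the order of vanishing (or of the
   pole) at i oo and the possible fractional exponent due to a multiplier. *)
Definition fourier_expansion (w : nat) (h : R) (a : nat -> R[i]) f : Prop :=
  exists (Y : R) (S : R[i] -> R[i]),
    (forall t, Im_gt Y t ->
       series (fun n : nat => a n * e (n%:R / w%:R * t)) @ \oo --> S t) /\
    mero_eq (Im_gt Y) f (fun t => e (h%:C * t) * S t).

Definition is_leading_coef f (c : R[i]) : Prop :=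
  c != 0 /\
  exists (w : nat) (h : R) (a : nat -> R[i]),
    [/\ (0 < w)%N, fourier_expansion w h a f & a 0%N = c].

Definition leading_coef f : R[i] := xget 0 [set c | is_leading_coef f c].

End MeromorphicFunctions.

Section ModularForms.
Variable R : realType.
Implicit Types (k : int) (g : 'M[int]_2) (f : R[i] -> R[i]).

Definition mx2 (a b c d : int) : 'M[int]_2 :=
  \matrix_(i < 2, j < 2)
    if i == 0 then (if j == 0 then a else b) else (if j == 0 then c else d).

Definition autfactor g (t : R[i]) : R[i] := (g 1 0)%:~R * t + (g 1 1)%:~R.

Definition mobius g (t : R[i]) : R[i] :=
  ((g 0 0)%:~R * t + (g 0 1)%:~R) / autfactor g t.

Definition slash k g f : R[i] -> R[i] := fun t =>
  ((\det g)%:~R `^ (k%:~R / 2))%:C * autfactor g t ^ (- k) * f (mobius g t).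

Definition SL2Z g : Prop := \det g = 1.

Definition Gamma0 (N : nat) g : Prop := SL2Z g /\ (N%:Z %| g 1%R 0%R)%Z.

Definition meromorphic_at_cusps k f : Prop :=
  forall g, SL2Z g -> exists (w : nat) (h : R) (a : nat -> R[i]),
    (0 < w)%N /\ fourier_expansion w h a (slash k g f).

Record wfun := WFun { weight : int; fn : R[i] -> R[i] }.

Definition wfun_eq (F G : wfun) : Prop :=
  weight F = weight G /\ mero_eq (@upper_half_plane R) (fn F) (fn G).

Definition in_M (N : nat) (F : wfun) : Prop :=
  let k := weight F in
  let f := fn F in
  [/\ meromorphic (@upper_half_plane R) f,
      exists chi : 'M[int]_2 -> R[i], forall g, Gamma0 N g ->
        `|chi g| = 1 /\
        mero_eq (@upper_half_plane R)
          (fun t => f (mobius g t))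
          (fun t => chi g * autfactor g t ^ k * f t),
      meromorphic_at_cusps k f &
      exists (h : R) (c : nat -> int),
        c 0%N = 1 /\ fourier_expansion 1 h (fun n => (c n)%:~R) f].

Definition sigma (n : nat) : nat := (\sum_(d <- divisors n) d)%N.

Definition hecke_exponent (l r : nat) k : R :=
  k%:~R / (1 - l%:R)
  * ((l%:R ^+ r.+1 - l%:R) / (l%:R - 1) - r%:R / 2 * (l%:R ^+ r.+1 + 1)).

Definition hecke_product (l r : nat) k f : R[i] -> R[i] := fun t =>
  (l%:R `^ hecke_exponent l r k)%:C
  * \prod_(d <- divisors (l ^ r))
      \prod_(0 <= b < d) slash k (mx2 (l ^ r %/ d)%N b 0 d) f t.

Definition hecke (l r : nat) (F : wfun) : wfun :=
  let P := hecke_product l r (weight F) (fn F) in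
  WFun (weight F * (sigma (l ^ r))%:Z) (fun t => (leading_coef P)^-1 * P t).

End ModularForms.

(* Main.v *)
(* Up to a nonzero constant, f|T(n) is the product of f((a t + b)/d) over
   ad = n and 0 <= b < d. Composing the products for coprime m and n gives the
   factors f((aa' t + ab' + bd')/(dd')) with ad = n, a'd' = m; since a is prime to d',
   ab' + bd' runs over the residues mod dd', and f(t + 1) is a constant multiple
   of f(t). So both orders of composition agree up to a constant with the same
   product. The normalization by leading coefficients removes this constant:
   leading coefficients are unique, and those of the inner operators exist because
   Fourier expansions can be multiplied (Cauchy product). *)

Require Import Defs.
From mathcomp Require Import all_boot all_order all_algebra.
From mathcomp Require Import complex.
From mathcomp Require Import all_classical all_reals all_analysis.
From mathcomp Require Import ring lra zify.

Set Implicit Arguments.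
Unset Strict Implicit.
Unset Printing Implicit Defensive.

Import Order.TTheory GRing.Theory Num.Theory.
Import numFieldNormedType.Exports.

Local Open Scope classical_set_scope.
Local Open Scope complex_scope.
Local Open Scope ring_scope.

(** * Power series over [R[i]]: Cauchy products and substitution of a power of the variable *)

Section Series.
Variable R : realType.
Implicit Types (u v : nat -> R[i]) (x y M : R[i]).

(* Restated at [R[i]] because unifying [cvgM] against composite sequences
   diverges on the instances of the norm topology. *)
Lemma cvgcM u v (U V : R[i]) : u @ \oo --> U -> v @ \oo --> V ->
  (fun n => u n * v n) @ \oo --> U * V.
Proof. exact: cvgM. Qed.

Lemma cvgcB u v (U V : R[i]) : u @ \oo --> U -> v @ \oo --> V ->
  (fun n => u n - v n) @ \oo --> U - V.
Proof. exact: cvgB. Qed.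

Lemma cvgcZ (c : R[i]) u (U : R[i]) : u @ \oo --> U ->
  (fun n => c * u n) @ \oo --> c * U.
Proof. by apply: cvgcM; exact: cvg_cst. Qed.

Lemma cvg_expc x : `|x| < 1 -> (fun n : nat => x ^+ n) @ \oo --> (0 : R[i]).
Proof.
(* A positive element of [R[i]] has imaginary part zero, so the tolerance is real and the claim
   becomes that of the real sequence of powers of [|x|]. *)
move=> x1; apply/cvgr0Pnorm_lt => -[er ei]; rewrite ltcE /= => /andP[/eqP-> er0].
have nx : `|x| = (complex.Re `|x|)%:C by rewrite normc_def.
have r1 : complex.Re `|x| < 1 by move: x1; rewrite ltcE => /andP[].
have r0 : 0 <= complex.Re `|x| by rewrite normc_def /= sqrtr_ge0.
have /cvg_expr/cvgr0Pnorm_lt/(_ _ er0) : `|complex.Re `|x| | < 1 by rewrite ger0_norm.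
apply: filterS => n; rewrite ger0_norm ?exprn_ge0 // => h.
by rewrite normrX nx -rmorphXn /= ltcR.
Qed.

Lemma sum_geometric_le x m n :
  0 <= x -> x < 1 -> \sum_(m <= j < n) x ^+ j <= (1 - x)^-1.
Proof.
move=> x0 x1; have x1' : 0 < 1 - x by rewrite subr_gt0.
have sum0 k : \sum_(0 <= j < k) x ^+ j <= (1 - x)^-1.
  rewrite -[leRHS]mul1r ler_pdivlMr // big_mkord mulrC.
  by rewrite -opprB mulNr -subrX1 opprB gerBl exprn_ge0.
case: (leqP m n) => mn; last by rewrite big_geq ?invr_ge0 ?ltW // ltnW.
apply: le_trans (sum0 n); rewrite (@big_cat_nat _ _ _ m 0) //= lerDr.
by apply: sumr_ge0 => i _; rewrite exprn_ge0.
Qed.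

Lemma sum_triangle (f : nat -> nat -> R[i]) N :
  \sum_(0 <= n < N) \sum_(0 <= i < n.+1) f i (n - i)%N
  = \sum_(0 <= i < N) \sum_(0 <= j < N - i) f i j.
Proof.
elim: N => [|N IH]; first by rewrite !big_geq.
rewrite big_nat_recr //= IH.
transitivity (\sum_(0 <= i < N.+1) (\sum_(0 <= j < N - i) f i j + f i (N - i)%N)).
  rewrite big_split /= [X in _ = X + _]big_nat_recr //= subnn.
  by rewrite [\sum_(0 <= j < 0) _]big_geq // addr0.
by apply: eq_big_nat => i /andP[_ iN]; rewrite subSn // big_nat_recr.
Qed.

Definition cauchy_prod u v n : R[i] := \sum_(0 <= i < n.+1) u i * v (n - i)%N.

(* The two partial sums differ by the terms with i, j < N <= i + j, which are
   bounded by M M' x ^ i x ^ j <= M M' y ^ N y ^ i y ^ j with y ^ 2 = x. *)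
Lemma cvg_series_cauchy_prod u v x M M' (U V : R[i]) : 0 <= x -> x < 1 ->
  (forall n, `|u n| <= M * x ^+ n) -> (forall n, `|v n| <= M' * x ^+ n) ->
  series u @ \oo --> U -> series v @ \oo --> V ->
  series (cauchy_prod u v) @ \oo --> U * V.
Proof.
move=> x0 x1 uM vM uU vV.
have M0 : 0 <= M by have := le_trans (normr_ge0 _) (uM 0%N); rewrite expr0 mulr1.
have M'0 : 0 <= M' by have := le_trans (normr_ge0 _) (vM 0%N); rewrite expr0 mulr1.
pose y := sqrtC x.
have y0 : 0 <= y by rewrite sqrtC_ge0.
have y1 : y < 1 by rewrite -sqrtC1 ltr_sqrtC ?qualifE /=.
have xy : x = y ^+ 2 by rewrite sqrtCK.
pose B := M * M' / (1 - y) / (1 - y).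
have B0 : 0 <= B by rewrite !mulr_ge0 ?invr_ge0 ?subr_ge0 // ltW.
have diff N : `|series u N * series v N - series (cauchy_prod u v) N| <= B * y ^+ N.
  rewrite /series /= /cauchy_prod (sum_triangle (fun i j => u i * v j)) mulr_suml -sumrB.
  have tail i : (0 <= i < N)%N ->
      u i * (\sum_(0 <= k < N) v k) - \sum_(0 <= j < N - i) u i * v j
      = \sum_(N - i <= j < N) u i * v j.
    move=> _; rewrite mulr_sumr (@big_cat_nat _ _ _ (N - i) 0) ?leq_subr //=.
    by rewrite addrAC subrr add0r.
  rewrite (eq_big_nat _ _ tail); apply: le_trans (ler_norm_sum _ _ _) _.
  have row i : (0 <= i < N)%N ->
      `|\sum_(N - i <= j < N) u i * v j| <= M * M' / (1 - y) * y ^+ N * y ^+ i.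
    move=> /andP[_ iN]; apply: le_trans (ler_norm_sum _ _ _) _.
    have term j : (N - i <= j < N)%N ->
        `|u i * v j| <= M * M' * y ^+ N * y ^+ i * y ^+ j.
      move=> /andP[Nij _]; rewrite normrM.
      apply: le_trans (ler_pM _ _ (uM i) (vM j)) _ => //.
      rewrite xy -!exprM mulrACA -!mulrA !ler_wpM2l // -!exprD.
      apply: ler_wiXn2l; rewrite ?(ltW y1) //.
      by move: Nij; rewrite leq_subLR => Nij; rewrite mulnC mul2n -addnn; lia.
    rewrite big_nat; apply: le_trans (ler_sum _ term) _; rewrite -big_nat -mulr_sumr.
    have -> : M * M' / (1 - y) * y ^+ N * y ^+ i
      = M * M' * y ^+ N * y ^+ i * (1 - y)^-1 by ring.
    by rewrite ler_wpM2l ?sum_geometric_le // !mulr_ge0 // exprn_ge0.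
  rewrite big_nat; apply: le_trans (ler_sum _ row) _; rewrite -big_nat -mulr_sumr.
  have -> : B * y ^+ N = M * M' / (1 - y) * y ^+ N * (1 - y)^-1 by rewrite /B; ring.
  rewrite ler_wpM2l ?sum_geometric_le // !mulr_ge0 ?exprn_ge0 //.
  by rewrite invr_ge0 subr_ge0 ltW.
have Y0 : (fun N => B * y ^+ N) @ \oo --> (0 : R[i]).
  rewrite -[X in _ --> X](mulr0 B); apply: cvgcZ.
  by apply: cvg_expc; rewrite ger0_norm.
have D0 : (fun N => series u N * series v N - series (cauchy_prod u v) N) @ \oo --> (0 : R[i]).
  apply/cvgr0Pnorm_lt => eps e0.
  move/cvgr0Pnorm_lt : Y0 => /(_ _ e0); apply: filterS => N; apply: le_lt_trans.
  by rewrite [leRHS]ger0_norm ?diff // mulr_ge0 ?exprn_ge0.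
have := cvgcB (cvgcM uU vV) D0; rewrite subr0.
rewrite (_ : (fun _ => _ - _) = series (cauchy_prod u v)) //.
by apply/funext => N; rewrite subKr.
Qed.

(** If [u] lists the coefficients of a power series in x, this lists those of the same series with x
    replaced by the [j]-th power of x. *)
Definition stretch j u n : R[i] := if (j %| n)%N then u (n %/ j)%N else 0.

Lemma cvg_series_stretch j u (U : R[i]) : (0 < j)%N ->
  series u @ \oo --> U -> series (stretch j u) @ \oo --> U.
Proof.
move=> j0 uU.
(* The index on the right is N / j rounded up, the number of multiples of [j] in [0, N). *)
have E N : series (stretch j u) N = series u ((N + j.-1) %/ j)%N.
  rewrite /series /=; elim: N => [|N IH].
    by rewrite add0n divn_small ?prednK // !big_geq.
  rewrite big_nat_recr //= IH /stretch.
  have -> : ((N.+1 + j.-1) %/ j = (N %/ j).+1)%N.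
    by rewrite addSnnS prednK // divnDr ?dvdnn // divnn j0 addn1.
  case: (boolP (j %| N)%N) => jN.
    rewrite big_nat_recr //=.
    by rewrite divnDl // (divn_small (m := j.-1)) ?prednK // addn0.
  rewrite addr0; congr bigop; congr (index_iota _ _).
  rewrite {1}(divn_eq N j) -addnA divnMDl // -addn1; congr addn.
  have r0 : (0 < N %% j)%N by rewrite lt0n.
  have rj : (N %% j < j)%N by rewrite ltn_pmod.
  have -> : (N %% j + j.-1 = (N %% j).-1 + 1 * j)%N by lia.
  by rewrite divnDMl // divn_small //; lia.
rewrite (_ : series (stretch j u) = series u \o (fun N => (N + j.-1) %/ j)%N); last first.
  by apply/funext => N /=; rewrite E.
apply: cvg_comp uU; apply/cvgnyPge => A.
exists (A * j)%N => // N /= AN; rewrite leq_divRL //; exact: leq_trans AN (leq_addr _ _).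
Qed.

End Series.

(** * Affine maps, the function [e] and equality of meromorphic functions *)

Lemma continuous_affine (K : numFieldType) (al be : K) :
  continuous (fun t : K => al * t + be).
Proof.
move=> z; apply: continuousD; last exact: cst_continuous.
by apply: continuousM; [exact: cst_continuous|move=> ?; exact].
Qed.

Section ExponentialFunction.
Variable R : realType.
Implicit Types (z w t : R[i]).

Lemma e0 : e (0 : R[i]) = 1.
Proof. by rewrite /e /= !mulr0 oppr0 expR0 cos0 sin0 mul1r. Qed.

Lemma eD z w : e (z + w) = e z * e w.
Proof.
case: z w => [a b] [c d]; rewrite /e /= !mulrDr opprD expRD cosD sinD.
by apply/eqP; rewrite eq_complex /=; apply/andP; split; apply/eqP; ring.
Qed.

Lemma e_neq0 z : e z != 0.
Proof.
apply/eqP => ez; have := eD z (- z).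
by rewrite ez mul0r subrr e0 => /eqP; rewrite oner_eq0.
Qed.

Lemma e_natM n z : e (n%:R * z) = e z ^+ n.
Proof.
elim: n => [|n IH]; first by rewrite mul0r e0.
by rewrite exprS -IH -eD mulrS mulrDl mul1r.
Qed.

Lemma norm_e z : `|e z| = (expR (- (2 * pi * complex.Im z)))%:C.
Proof.
rewrite /e normrM [X in _ * X]normc_def /= cos2Dsin2 sqrtr1 mulr1.
by rewrite normc_def /= expr0n addr0 sqrtr_sqr ger0_norm // expR_ge0.
Qed.

Lemma Im_realM (x : R) z : complex.Im (x%:C * z) = x * complex.Im z.
Proof. by case: z => a b /=; rewrite mul0r addr0. Qed.

Lemma natr_complex n : (n%:R : R[i]) = (n%:R : R)%:C.
Proof. by rewrite rmorph_nat. Qed.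

Lemma Im_divn z n : complex.Im (z / n%:R) = complex.Im z / n%:R.
Proof.
by rewrite natr_complex mulrC -fmorphV Im_realM mulrC.
Qed.

Lemma Im_natM z n : complex.Im (n%:R * z) = n%:R * complex.Im z.
Proof. by rewrite natr_complex Im_realM. Qed.

Lemma norm_e_lt1 z : 0 < complex.Im z -> `|e z| < 1.
Proof.
move=> z0; rewrite norm_e -(rmorph1 (real_complex R)) ltcR -expR0 ltr_expR.
by rewrite oppr_lt0 !mulr_gt0 // pi_gt0.
Qed.

Lemma norm_Im_le z : `|complex.Im z|%:C <= `|z|.
Proof.
rewrite normc_def lecR -sqrtr_sqr ler_wsqrtr //.
by rewrite lerDr sqr_ge0.
Qed.

Lemma Im_gt_ball (Y : R) z t : Y + 1 < complex.Im z -> ball z 1 t -> Y < complex.Im t.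
Proof.
move=> Yz; rewrite -ball_normE /ball_ /= => zt.
have := le_lt_trans (norm_Im_le (z - t)) zt.
rewrite -(rmorph1 (real_complex R)) ltcR => /ltr_normlW.
by case: z t Yz {zt} => a b [c d] /= Yz; lra.
Qed.

(** Meromorphic equality gives no information at a prescribed point, so two expressions for the same
    function are compared at points chosen for this purpose, arbitrarily high up. *)
Lemma mero_eq_ex (Y : R) (f g g' : R[i] -> R[i]) :
  mero_eq (Im_gt Y) f g -> mero_eq (Im_gt Y) f g' ->
  forall y : R, exists t, [/\ Y < complex.Im t, y < complex.Im t & g t = g' t].
Proof.
(* The margin 2 leaves room for the ball of radius 1 around [z], in which the imaginary part drops
   by less than 1. *)
move=> fg fg' y; pose z : R[i] := 0 +i* (Num.max Y y + 2).
have mY : Y <= Num.max Y y by rewrite le_max lexx.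
have my : y <= Num.max Y y by rewrite le_max lexx orbT.
have Yz : Im_gt Y z by rewrite /Im_gt /=; lra.
have B1 : \forall t \near z^', ball z 1 t.
  by apply: filterS (dnbhs_ball z (@ltr01 R[i])) => t [].
have [t [[ft ft'] zt]] := filter_ex (filterI (filterI (fg z Yz) (fg' z Yz)) B1).
have It : Num.max Y y < complex.Im t by apply: Im_gt_ball zt; rewrite /=; lra.
by exists t; rewrite -ft; split => //; [exact: le_lt_trans It|exact: le_lt_trans It].
Qed.

Lemma mero_eq_refl U (f : R[i] -> R[i]) : mero_eq U f f.
Proof. by move=> z _; exact: nearW. Qed.

Lemma mero_eq_sym U (f g : R[i] -> R[i]) : mero_eq U f g -> mero_eq U g f.
Proof. by move=> fg z /fg; apply: filterS => t ->. Qed.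

Lemma mero_eq_trans U (g f h : R[i] -> R[i]) :
  mero_eq U f g -> mero_eq U g h -> mero_eq U f h.
Proof.
move=> fg gh z Uz; apply: filterS2 (fg z Uz) (gh z Uz) => t -> //.
Qed.

Lemma mero_eqM U (f f' g g' : R[i] -> R[i]) :
  mero_eq U f f' -> mero_eq U g g' ->
  mero_eq U (fun t => f t * g t) (fun t => f' t * g' t).
Proof.
by move=> ff' gg' z Uz; apply: filterS2 (ff' z Uz) (gg' z Uz) => t -> ->.
Qed.

Lemma mero_eq_sub (U V : set R[i]) (f g : R[i] -> R[i]) :
  U `<=` V -> mero_eq V f g -> mero_eq U f g.
Proof. by move=> UV fg z /UV /fg. Qed.

(** An affine map with nonzero slope is continuous and injective, hence carries small punctured
    neighbourhoods into punctured neighbourhoods. *)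
Lemma mero_eq_affine (U V : set R[i]) (al be : R[i]) (f g : R[i] -> R[i]) :
  al != 0 -> (forall z, U z -> V (al * z + be)) ->
  mero_eq V f g -> mero_eq U (fun t => f (al * t + be)) (fun t => g (al * t + be)).
Proof.
move=> al0 UV fg z /UV /fg.
have phi : (fun t => al * t + be) @ z^' --> (al * z + be)^'.
  apply: (continuous_injective_withinNx (f := fun t : R[i] => al * t + be)).
    exact: continuous_affine.
  by move=> y /addIr /(mulfI al0).
exact: phi.
Qed.

End ExponentialFunction.

(** * Fourier expansions: products, affine substitutions and uniqueness of the leading
    coefficient *)

Section FourierExpansions.
Variable R : realType.
Implicit Types (f g : R[i] -> R[i]) (a : nat -> R[i]) (c t z : R[i]).

Lemma e_shift (w n : nat) t t0 :
  e (n%:R / w%:R * t) = e (n%:R / w%:R * t0) * e ((t - t0) / w%:R) ^+ n.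
Proof. by rewrite -e_natM -eD; congr e; ring. Qed.

Lemma coef_bound (w : nat) a t0 (l : R[i]) :
  series (fun n => a n * e (n%:R / w%:R * t0)) @ \oo --> l ->
  exists2 M : R[i], 0 <= M & forall n t,
    `|a n * e (n%:R / w%:R * t)| <= M * `|e ((t - t0) / w%:R)| ^+ n.
Proof.
move=> al.
have u0 : (fun n => a n * e (n%:R / w%:R * t0)) @ \oo --> (0 : R[i]).
  by apply: cvg_series_cvg_0; apply/cvg_ex; exists l.
have /cvg_seq_bounded/pinfty_ex_gt0[M M0 aM] :
    cvgn (fun n => a n * e (n%:R / w%:R * t0)) by apply/cvg_ex; exists 0.
exists M => [|n t]; first exact: ltW.
rewrite (e_shift w n t t0) mulrA normrM normrX ler_wpM2r ?exprn_ge0 //.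
exact: aM.
Qed.

Lemma fourier_expansionM (w : nat) (h h' : R) a a' f f' : (0 < w)%N ->
  fourier_expansion w h a f -> fourier_expansion w h' a' f' ->
  fourier_expansion w (h + h') (cauchy_prod a a') (fun t => f t * f' t).
Proof.
move=> w0 [Y [S [aS fS]]] [Y' [S' [aS' fS']]].
(* The point [t0] lies strictly inside both half-planes of convergence. For Im t > T the ratio in
   [coef_bound] is less than 1, which provides the geometric majorants for the Cauchy product. *)
pose T := Num.max Y Y' + 1; pose t0 : R[i] := 0 +i* T.
have YT : Y < T by rewrite ltr_pwDr ?le_max ?lexx.
have Y'T : Y' < T by rewrite ltr_pwDr ?le_max ?lexx ?orbT.
have [|M M0 aM] := coef_bound (aS t0 _); first by rewrite /Im_gt /=; lra.
have [|M' M'0 aM'] := coef_bound (aS' t0 _); first by rewrite /Im_gt /=; lra.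
exists T, (fun t => S t * S' t); split => [t Tt|].
  have Yt : Im_gt Y t by rewrite /Im_gt /= in Tt *; lra.
  have Y't : Im_gt Y' t by rewrite /Im_gt /= in Tt *; lra.
  have := cvg_series_cauchy_prod (normr_ge0 _) _ (fun n => aM n t) (fun n => aM' n t)
            (aS t Yt) (aS' t Y't).
  rewrite (_ : cauchy_prod _ _ = fun n => cauchy_prod a a' n * e (n%:R / w%:R * t)).
    apply; apply: norm_e_lt1; rewrite Im_divn divr_gt0 ?ltr0n //.
    by case: (t) Tt => x y; rewrite /Im_gt /= subr_gt0.
  apply/funext => n; rewrite /cauchy_prod mulr_suml; apply: eq_big_nat => i /andP[_ ni].
  rewrite mulrACA -eD; congr (_ * e _); rewrite -mulrDl -mulrDl -natrD subnKC //.
have sub U : U < T -> Im_gt T `<=` Im_gt U.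
  by move=> UT t; exact: lt_trans.
apply: mero_eq_trans.
  exact: mero_eqM (mero_eq_sub (sub Y YT) fS) (mero_eq_sub (sub Y' Y'T) fS').
rewrite (_ : (fun t => _) = fun t => e ((h + h')%:C * t) * (S t * S' t)); first exact: mero_eq_refl.
by apply/funext => t; rewrite rmorphD mulrDl eD mulrACA.
Qed.

Lemma fourier_expansionZ (w : nat) (h : R) a f c :
  fourier_expansion w h a f ->
  fourier_expansion w h (fun n => c * a n) (fun t => c * f t).
Proof.
move=> [Y [S [aS fS]]]; exists Y, (fun t => c * S t); split => [t Yt|].
  have := cvgcZ (c := c) (aS t Yt).
  rewrite (_ : (fun n => c * _) = series (fun n => c * a n * e (n%:R / w%:R * t))) //.
  apply/funext => n; rewrite /series /= mulr_sumr.
  by apply: eq_bigr => i _; rewrite mulrA.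
move=> z /fS; apply: filterS => t ->; ring.
Qed.

(** Substituting (A t + B) / D turns the term of index n into a constant times e(A n t / (w D)). At
    width w D the coefficients thus sit at the multiples of A, and the factor e(h t) contributes the
    constant e(h B / D). *)
Lemma fourier_expansion_affine (w A B D : nat) (h : R) a f :
  (0 < w)%N -> (0 < A)%N -> (0 < D)%N -> fourier_expansion w h a f ->
  fourier_expansion (w * D) (h * A%:R / D%:R)
    (fun m => e (h%:C * (B%:R / D%:R))
       * stretch A (fun n => a n * e (n%:R / w%:R * (B%:R / D%:R))) m)
    (fun t => f ((A%:R * t + B%:R) / D%:R)).
Proof.
move=> w0 A0 D0 [Y [S [aS fS]]].
have AC : (A%:R : R[i]) != 0 by rewrite pnatr_eq0 -lt0n.
have DC : (D%:R : R[i]) != 0 by rewrite pnatr_eq0 -lt0n.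
have wC : (w%:R : R[i]) != 0 by rewrite pnatr_eq0 -lt0n.
have phiE t : (A%:R * t + B%:R) / D%:R = A%:R / D%:R * t + B%:R / D%:R :> R[i].
  by rewrite mulrDl mulrAC.
have YY z : Im_gt (Y * D%:R / A%:R) z -> Im_gt Y (A%:R / D%:R * z + B%:R / D%:R).
  rewrite -phiE /Im_gt /= Im_divn raddfD /= Im_natM natr_complex /= addr0.
  by rewrite ltr_pdivrMr ?ltr0n // ltr_pdivlMr ?ltr0n // [A%:R * _]mulrC.
pose c := e (h%:C * (B%:R / D%:R)).
exists (Y * D%:R / A%:R), (fun t => c * S ((A%:R * t + B%:R) / D%:R)); split => [t Yt|].
  have Yt' := YY _ Yt; rewrite -phiE in Yt'.
  have := cvgcZ (c := c) (cvg_series_stretch A0 (aS _ Yt')).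
  rewrite (_ : (fun n => c * _) = series (fun m => c
    * stretch A (fun n => a n * e (n%:R / w%:R * (B%:R / D%:R))) m
    * e (m%:R / (w * D)%:R * t))) //.
  apply/funext => n; rewrite /series /= mulr_sumr.
  apply: eq_bigr => m _; rewrite /stretch; case: ifP => Am; last by rewrite !mulr0 mul0r.
  rewrite -!(mulrA c) -(mulrA (a _)) -eD; congr (_ * (_ * e _)).
  have -> : (m%:R : R[i]) = (m %/ A)%:R * A%:R by rewrite -natrM divnK.
  rewrite natrM; field.
  by rewrite DC wC.
rewrite (_ : (fun t => f _) = fun t => f (A%:R / D%:R * t + B%:R / D%:R)); last first.
  by apply/funext => t; rewrite phiE.
apply: mero_eq_trans (mero_eq_affine _ YY fS) _.
  by rewrite mulf_neq0 ?invr_neq0.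
rewrite (_ : (fun t => _) = fun t => e ((h * A%:R / D%:R)%:C * t)
  * (c * S ((A%:R * t + B%:R) / D%:R))); first exact: mero_eq_refl.
apply/funext => t; rewrite phiE mulrA /c -eD; congr (e _ * _).
by rewrite !rmorphM fmorphV !rmorph_nat; ring.
Qed.

(** The term of index 0 is constant, and the others are dominated by a geometric series whose sum
    decays like [rho ^+ m], where [rho] is the factor by which |e(t / w)| shrinks when Im t grows by
    1. *)
Lemma fourier_expansion_lim (w : nat) a t0 (l : R[i]) (t : nat -> R[i]) :
  (0 < w)%N ->
  series (fun n => a n * e (n%:R / w%:R * t0)) @ \oo --> l ->
  (forall n, complex.Im t0 + n%:R < complex.Im (t n)) ->
  forall S : nat -> R[i],
  (forall m, series (fun n => a n * e (n%:R / w%:R * t m)) @ \oo --> S m) ->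
  S @ \oo --> a 0%N.
Proof.
move=> w0 al tI S aS; have [M M0 aM] := coef_bound al.
pose rho := `|e ((0 +i* 1 : R[i]) / w%:R)|.
have rho0 : 0 < rho by rewrite normr_gt0 e_neq0.
have rho1 : rho < 1 by apply: norm_e_lt1; rewrite Im_divn divr_gt0 ?ltr0n.
have r1 : 0 < 1 - rho by rewrite subr_gt0.
have xr m : `|e ((t m - t0) / w%:R)| <= rho ^+ m.
  rewrite /rho -normrX -e_natM !norm_e lecR ler_expR lerN2.
  rewrite ler_wpM2l ?mulr_ge0 ?pi_ge0 // !(Im_divn, Im_natM) /= mulrA mulr1.
  rewrite ler_wpM2r ?invr_ge0 //; have := tI m.
  by case: (t m) => ? ?; case: (t0) => ? ? /=; lra.
(* The summand 1 pays for replacing [S m] by a nearby partial sum, and M / (1 - rho) for its terms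
   of positive index. The condition [0 < m] gives [rho ^+ m <= rho], so that the ratio of the
   majorant can be taken to be [rho]. *)
have bound m : (0 < m)%N -> `|a 0%N - S m| <= (1 + M / (1 - rho)) * rho ^+ m.
  move=> m0.
  have /cvgrPdist_lt/(_ _ (exprn_gt0 m rho0)) [N _ NS] := aS m.
  have := NS N.+1 (leqnSn N) => /= SN.
  apply: le_trans (ler_distD (series (fun n => a n * e (n%:R / w%:R * t m)) N.+1) _ _) _.
  rewrite mulrDl mul1r addrC; apply: lerD; first by rewrite distrC ltW.
  rewrite distrC /series /= big_nat_recl // !mul0r e0 mulr1 [a _ + _]addrC addrK.
  apply: le_trans (ler_norm_sum _ _ _) _.
  have term n : (0 <= n < N)%N ->
      `|a n.+1 * e (n.+1%:R / w%:R * t m)| <= M * rho ^+ m * rho ^+ n.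
    move=> _; apply: le_trans (aM n.+1 (t m)) _; rewrite -mulrA ler_wpM2l //.
    rewrite exprS ler_pM ?exprn_ge0 ?xr // lerXn2r ?qualifE /= ?(ltW rho0) //.
    apply: le_trans (xr m) _; rewrite -[leRHS]expr1.
    by apply: ler_wiXn2l; rewrite ?(ltW rho0) ?(ltW rho1).
  rewrite big_nat; apply: le_trans (ler_sum _ term) _; rewrite -big_nat -mulr_sumr.
  rewrite [leRHS]mulrAC ler_wpM2l ?sum_geometric_le ?mulr_ge0 ?exprn_ge0 // ltW //.
have C0 : 0 <= 1 + M / (1 - rho) by rewrite addr_ge0 // divr_ge0 // ltW.
have B0 : (fun m => (1 + M / (1 - rho)) * rho ^+ m) @ \oo --> (0 : R[i]).
  rewrite -[X in _ --> X](mulr0 (1 + M / (1 - rho))).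
  by apply: cvgcZ; apply: cvg_expc; rewrite normr_id.
apply/cvgrPdist_lt => eps eps0.
move/cvgr0Pnorm_lt : B0 => /(_ _ eps0); apply: filterS2 (nbhs_infty_gt 0) => m m0.
apply: le_lt_trans; rewrite [leRHS]ger0_norm; first exact: bound.
by rewrite mulr_ge0 // exprn_ge0 // ltW.
Qed.

(* Comparing growth as Im t goes to infinity forces both exponents to agree,
   since otherwise one of the leading coefficients would vanish; both are then
   the limit of the same function. *)
Lemma is_leading_coef_unique f c c' :
  is_leading_coef f c -> is_leading_coef f c' -> c = c'.
Proof.
move=> [c0 [w [h [a [w0 [Y [S [aS fS]]] ac]]]]].
move=> [c0' [w' [h' [a' [w0' [Y' [S' [aS' fS']]] ac']]]]].
wlog hh' : c c' c0 c0' w w' h h' a a' w0 w0' ac ac' Y Y' S S' aS aS' fS fS' /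
    h <= h' => [H|].
  have [hh|/ltW hh] := leP h h'.
    exact: (H c c' _ _ w w' h h' a a' _ _ _ _ Y Y' S S').
  exact/esym/(H c' c _ _ w' w h' h a' a _ _ _ _ Y' Y S' S).
pose T := Num.max Y Y' + 1; pose t0 : R[i] := 0 +i* T.
have YT : Y < T by rewrite ltr_pwDr ?le_max ?lexx.
have Y'T : Y' < T by rewrite ltr_pwDr ?le_max ?lexx ?orbT.
have TY : Im_gt Y t0 by rewrite /Im_gt /=; lra.
have TY' : Im_gt Y' t0 by rewrite /Im_gt /=; lra.
have sub U : U < T -> Im_gt T `<=` Im_gt U.
  by move=> UT t; exact: lt_trans.
have fST : mero_eq (Im_gt T) f (fun t => e (h%:C * t) * S t).
  exact: mero_eq_sub (sub Y YT) fS.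
have fST' : mero_eq (Im_gt T) f (fun t => e (h'%:C * t) * S' t).
  exact: mero_eq_sub (sub Y' Y'T) fS'.
(* The limits are taken along points at which both expansions agree exactly and whose imaginary
   parts tend to infinity. *)
have /choice[t tE] : forall n : nat, exists t, [/\ T < complex.Im t,
    T + n%:R < complex.Im t & e (h%:C * t) * S t = e (h'%:C * t) * S' t].
  by move=> n; exact: mero_eq_ex fST fST' (T + n%:R).
have tT n : T < complex.Im (t n) by case: (tE n).
have Sc : (fun n => S (t n)) @ \oo --> c.
  rewrite -ac; apply: (fourier_expansion_lim (t := t) w0 (aS _ TY) _ _) => n.
    by case: (tE n).
  by apply: aS; exact: sub YT _ (tT n).
have Sc' : (fun n => S' (t n)) @ \oo --> c'.
  rewrite -ac'; apply: (fourier_expansion_lim (t := t) w0' (aS' _ TY') _ _) => n.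
    by case: (tE n).
  by apply: aS'; exact: sub Y'T _ (tT n).
have SE n : S (t n) = e ((h' - h)%:C * t n) * S' (t n).
  apply: (mulfI (e_neq0 (h%:C * t n))); rewrite mulrA -eD -mulrDl -rmorphD subrKC.
  by case: (tE n).
have hausC := @norm_hausdorff R[i] R[i].
move: hh'; rewrite le_eqVlt => /predU1P[hh|hh].
  apply: (cvg_unique hausC Sc); rewrite (_ : (fun n => S (t n)) = fun n => S' (t n)) //.
  by apply/funext => n; rewrite SE hh subrr mul0r e0 mul1r.
have E0 : (fun n => e ((h' - h)%:C * t n)) @ \oo --> (0 : R[i]).
  pose rho := `|e ((0 +i* (h' - h)) : R[i])|.
  have rho1 : rho < 1 by apply: norm_e_lt1; rewrite /= subr_gt0.
  (* As Im (t n) exceeds T + n, this sequence dominates the factor in modulus. *)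
  have : (fun n => e ((h' - h)%:C * t0) * rho ^+ n) @ \oo --> (0 : R[i]).
    rewrite -[X in _ --> X](mulr0 (e ((h' - h)%:C * t0))).
    by apply: cvgcZ; apply: cvg_expc; rewrite normr_id.
  move=> /cvgr0Pnorm_lt B0; apply/cvgr0Pnorm_lt => eps /B0; apply: filterS => n.
  apply: le_lt_trans; rewrite [leRHS]normrM normrX normr_id /rho -normrX -e_natM -normrM -eD.
  rewrite !norm_e lecR ler_expR lerN2 ler_wpM2l ?mulr_ge0 ?pi_ge0 //.
  rewrite raddfD /= Im_natM !Im_realM /= -/T.
  have [_ /ltW Tn _] := tE n.
  have := ler_wpM2l (ltW (_ : 0 < h' - h)) Tn; rewrite subr_gt0 => /(_ hh).
  by rewrite mulrDr mulr0 addr0 [_ * n%:R]mulrC.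
have := cvgcM E0 Sc'; rewrite mul0r.
rewrite (_ : (fun n => e _ * _) = fun n => S (t n)); last first.
  by apply/funext => n; rewrite SE.
move=> /(cvg_unique hausC Sc) cE.
by rewrite cE eqxx in c0.
Qed.


End FourierExpansions.

(** * Leading coefficients, proportionality and normalization *)

Section LeadingCoefficients.
Variable R : realType.
Implicit Types (f g : R[i] -> R[i]) (c d : R[i]).
Local Notation H := (@upper_half_plane R).

(** The affine substitution with A = D = j and B = 0 is the identity but multiplies the width by j.
    This brings two expansions to a common width before they are multiplied. *)
Lemma fourier_expansion_stretch (w j : nat) (h : R) (a : nat -> R[i]) f :
  (0 < w)%N -> (0 < j)%N -> fourier_expansion w h a f ->
  fourier_expansion (w * j) h (stretch j a) f.
Proof.
move=> w0 j0 /(fourier_expansion_affine 0 w0 j0 j0).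
have jR : (j%:R : R) != 0 by rewrite pnatr_eq0 -lt0n.
have jC : (j%:R : R[i]) != 0 by rewrite pnatr_eq0 -lt0n.
rewrite mulfK // mul0r mulr0 e0.
rewrite (_ : (fun m => 1 * _) = stretch j a); last first.
  by apply/funext => m; rewrite mul1r /stretch mulr0 e0 mulr1.
rewrite (_ : (fun t => f _) = f) //.
by apply/funext => t; rewrite addr0 mulrAC divff // mul1r.
Qed.

Lemma is_leading_coefM f g c d : is_leading_coef f c -> is_leading_coef g d ->
  is_leading_coef (fun t => f t * g t) (c * d).
Proof.
move=> [c0 [w [h [a [w0 fa ac]]]]] [d0 [w' [h' [b [w0' gb bd]]]]].
split; first by rewrite mulf_neq0.
exists (w * w')%N, (h + h'), (cauchy_prod (stretch w' a) (stretch w b)).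
split; first by rewrite muln_gt0 w0 w0'.
- apply: fourier_expansionM; first by rewrite muln_gt0 w0 w0'.
    exact: fourier_expansion_stretch.
  by rewrite mulnC; exact: fourier_expansion_stretch.
- by rewrite -ac -bd /cauchy_prod big_nat1 subn0 /stretch !dvdn0 !div0n.
Qed.

Lemma is_leading_coefZ f c d :
  c != 0 -> is_leading_coef f d -> is_leading_coef (fun t => c * f t) (c * d).
Proof.
move=> c0 [d0 [w [h [a [w0 fa ad]]]]]; split; first by rewrite mulf_neq0.
exists w, h, (fun n => c * a n); split => //; last by rewrite ad.
exact: fourier_expansionZ.
Qed.

Lemma is_leading_coef1 : is_leading_coef (fun=> 1 : R[i]) 1.
Proof.
split; first exact: oner_neq0.
exists 1%N, 0, (fun n => (n == 0%N)%:R); split => //.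
exists 0, (fun=> 1); split => [t _|].
  apply: cvg_near_cst; exists 1%N => // n /= n0.
  case: n n0 => // n _; rewrite /series /= big_nat_recl //= big1 ?addr0.
    by rewrite !mul0r e0 mul1r.
  by move=> i _; rewrite mul0r.
rewrite (_ : (fun t => e _ * 1) = fun=> 1); first exact: mero_eq_refl.
by apply/funext => t; rewrite mul0r e0 mulr1.
Qed.

Lemma is_leading_coef_affine (A B D : nat) f c : (0 < A)%N -> (0 < D)%N ->
  is_leading_coef f c ->
  exists d, is_leading_coef (fun t => f ((A%:R * t + B%:R) / D%:R)) d.
Proof.
move=> A0 D0 [c0 [w [h [a [w0 fa ac]]]]].
have fa' := fourier_expansion_affine B w0 A0 D0 fa.
eexists; split; last first.
  by eexists _, _, _; split; [|exact: fa'|reflexivity]; rewrite muln_gt0 w0 D0.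
by rewrite mulf_neq0 ?e_neq0 // /stretch dvdn0 div0n mul0r mul0r e0 mulr1 ac.
Qed.

Lemma is_leading_coef_prod (I : eqType) (s : seq I) (F : I -> R[i] -> R[i]) :
  (forall i, i \in s -> exists c, is_leading_coef (F i) c) ->
  exists c, is_leading_coef (fun t => \prod_(i <- s) F i t) c.
Proof.
elim: s => [_|i s IH Fs].
  exists 1; rewrite (_ : (fun t => _) = fun=> 1); first exact: is_leading_coef1.
  by apply/funext => t; rewrite big_nil.
have [c Fc] := Fs i (mem_head _ _).
have [j js|d Fd] := IH; first by apply: Fs; rewrite inE js orbT.
exists (c * d); rewrite (_ : (fun t => _) = fun t => F i t * \prod_(i <- s) F i t).
  exact: is_leading_coefM.
by apply/funext => t; rewrite big_cons.
Qed.

Lemma is_leading_coef_mero_eq f g c :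
  mero_eq H f g -> is_leading_coef f c -> is_leading_coef g c.
Proof.
move=> fg [c0 [w [h [a [w0 [Y [S [aS fS]]] ac]]]]]; split => //.
(* The height is raised to at least 0, since [f] and [g] are only compared on the upper
   half-plane. *)
exists w, h, a; split => //; exists (Num.max Y 0), S.
have sub U : U <= Num.max Y 0 -> Im_gt (Num.max Y 0) `<=` Im_gt U.
  by move=> UT t; exact: le_lt_trans.
have subY : Im_gt (Num.max Y 0) `<=` Im_gt Y by apply: sub; rewrite le_max lexx.
have sub0 : Im_gt (Num.max Y 0) `<=` Im_gt 0.
  by apply: sub; rewrite le_max lexx orbT.
split => [t /subY|]; first exact: aS.
apply: mero_eq_trans (mero_eq_sub subY fS).
exact: mero_eq_sub sub0 (mero_eq_sym fg).
Qed.

(** Uniqueness makes the choice by [xget] determinate. *)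
Lemma leading_coefE f c : is_leading_coef f c -> leading_coef f = c.
Proof.
by move=> fc; apply: is_leading_coef_unique (fc); exact: (xgetI _ fc).
Qed.

Definition normalize f : R[i] -> R[i] := fun t => (leading_coef f)^-1 * f t.

(** This relation absorbs the powers of [l], the slash factors, the multiplier of the translation
    and the inner normalizations. *)
Definition prop_eq f g := exists2 c, c != 0 & mero_eq H f (fun t => c * g t).

Lemma prop_eq_refl f : prop_eq f f.
Proof.
exists 1; first exact: oner_neq0.
by move=> z _; apply: nearW => t; rewrite mul1r.
Qed.

Lemma prop_eq_sym f g : prop_eq f g -> prop_eq g f.
Proof.
move=> [c c0 fg]; exists c^-1; rewrite ?invr_neq0 // => z /fg.
by apply: filterS => t ->; rewrite mulKf.
Qed.

Lemma prop_eq_trans g f h : prop_eq f g -> prop_eq g h -> prop_eq f h.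
Proof.
move=> [c c0 fg] [d d0 gh]; exists (c * d); rewrite ?mulf_neq0 // => z Hz.
by apply: filterS2 (fg z Hz) (gh z Hz) => t -> ->; rewrite mulrA.
Qed.

Lemma prop_eq_prod (I : eqType) (s : seq I) (F G : I -> R[i] -> R[i]) :
  (forall i, i \in s -> prop_eq (F i) (G i)) ->
  prop_eq (fun t => \prod_(i <- s) F i t) (fun t => \prod_(i <- s) G i t).
Proof.
elim: s => [_|i s IH FG].
  exists 1; first exact: oner_neq0.
  by move=> z _; apply: nearW => t; rewrite !big_nil mul1r.
have [c c0 FGi] := FG i (mem_head _ _).
have [j js|d d0 FGs] := IH; first by apply: FG; rewrite inE js orbT.
exists (c * d); rewrite ?mulf_neq0 // => z Hz.
apply: filterS2 (FGi z Hz) (FGs z Hz) => t Ei Es.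
by rewrite !big_cons Ei Es mulrACA.
Qed.

(** A constant factor multiplies the function and its leading coefficient alike, so it cancels in
    the quotient. *)
Lemma mero_eq_normalize f g : prop_eq f g -> mero_eq H (normalize f) (normalize g).
Proof.
move=> fg; have [c c0 fcg] := fg.
suff -> : normalize f = fun t => (leading_coef g)^-1 * (c^-1 * f t).
  by move=> z /fcg; apply: filterS => t ->; rewrite mulKf.
apply/funext => t; rewrite /normalize mulrA -invfM; congr (_^-1 * _).
have [[d gd]|nog] := pselect (exists d, is_leading_coef g d).
  rewrite (leading_coefE gd) mulrC; apply: leading_coefE.
  exact: is_leading_coef_mero_eq (mero_eq_sym fcg) (is_leading_coefZ c0 gd).
(* Without a leading coefficient on either side, both values of [leading_coef] are the default 0,
   and the equality still holds. *)
rewrite /leading_coef !xgetPN ?mul0r //= => d fd; apply: nog; first by exists d.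
have [b b0 gf] := prop_eq_sym fg; exists (b * d).
exact: is_leading_coef_mero_eq (mero_eq_sym gf) (is_leading_coefZ b0 fd).
Qed.

End LeadingCoefficients.

(** * Hecke products up to constants and their composition *)

Section HeckeProducts.
Variable R : realType.
Implicit Types (f g : R[i] -> R[i]) (c t : R[i]).
Local Notation H := (@upper_half_plane R).

(** The Hecke product without its constants. It no longer involves the weight, so that composing two
    of them only composes the affine arguments. *)
Definition hprod (n : nat) f t : R[i] :=
  \prod_(d <- divisors n) \prod_(0 <= b < d)
    f (((n %/ d)%:R * t + b%:R) / d%:R).

Lemma hprodZ n c f : c != 0 ->
  exists2 k, k != 0 & forall t, hprod n (fun t => c * f t) t = k * hprod n f t.
Proof.
move=> c0; exists (\prod_(d <- divisors n) \prod_(0 <= b < d) c).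
  by rewrite prodf_seq_neq0; apply/allP => d _ /=; rewrite prodf_seq_neq0; apply/allP.
move=> t; rewrite /hprod -big_split /=; apply: eq_bigr => d _.
by rewrite -big_split.
Qed.

Lemma is_leading_coef_hprod n f c : (0 < n)%N ->
  is_leading_coef f c -> exists d, is_leading_coef (hprod n f) d.
Proof.
move=> n0 fc; apply: is_leading_coef_prod => d; rewrite -dvdn_divisors // => dn.
apply: is_leading_coef_prod => b _; have d0 := dvdn_gt0 n0 dn.
by apply: (is_leading_coef_affine b _ d0 fc); rewrite divn_gt0 // dvdn_leq.
Qed.

Lemma det_mx2 (a b c d : int) : \det (mx2 a b c d) = a * d - b * c.
Proof.
rewrite (expand_det_row _ ord0) !big_ord_recl big_ord0 /cofactor !det_mx11 !mxE /=.
by rewrite /bump /= !expr0 expr1; ring.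
Qed.

Lemma slash_mx2 (a b d : nat) (k : int) f t :
  slash k (mx2 a b 0 d) f t =
  ((((a * d)%N%:R : R) `^ (k%:~R / 2))%:C * d%:R ^ (- k))
  * f ((a%:R * t + b%:R) / d%:R).
Proof.
rewrite /slash /mobius /autfactor det_mx2 !mxE /= mulr0 subr0 mul0r add0r.
by rewrite -PoszM -!pmulrn.
Qed.

(** The matrices are upper triangular, so their determinant and automorphy factors do not depend on
    t and collect into one nonzero constant. *)
Lemma hecke_productE l r (k : int) f : prime l ->
  exists2 c, c != 0 & forall t, hecke_product l r k f t = c * hprod (l ^ r) f t.
Proof.
move=> pl; have l0 := prime_gt0 pl.
have n0 : (0 < l ^ r)%N by rewrite expn_gt0 l0.
pose K (d : nat) : R[i] :=
  ((((l ^ r)%N%:R : R) `^ (k%:~R / 2))%:C * d%:R ^ (- k)).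
have pow0 (n : nat) (x : R) : (0 < n)%N -> (((n%:R : R) `^ x)%:C : R[i]) != 0.
  by move=> n1; rewrite fmorph_eq0 gt_eqF // powR_gt0 // ltr0n.
exists ((l%:R `^ hecke_exponent R l r k)%:C
    * \prod_(d <- divisors (l ^ r)) \prod_(0 <= b < d) K d).
  rewrite mulf_neq0 ?pow0 // prodf_seq_neq0; apply/allP => d dn /=.
  rewrite prodf_seq_neq0; apply/allP => b _ /=; rewrite mulf_neq0 ?pow0 // expfz_neq0 //.
  by move: dn; rewrite -dvdn_divisors // pnatr_eq0 -lt0n; exact: dvdn_gt0.
move=> t; rewrite /hecke_product /hprod -mulrA -big_split /=; congr (_ * _).
rewrite big_seq [RHS]big_seq; apply: eq_bigr => d.
rewrite -dvdn_divisors // => dn; rewrite -big_split /=.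
by apply: eq_bigr => b _; rewrite slash_mx2 divnK.
Qed.

(** Lowering B by D shifts the argument of [f] by 1, which costs a constant; induction on the
    quotient B / D reaches the residue. *)
Lemma prop_eq_periodic f (A D B : nat) : (0 < A)%N -> (0 < D)%N ->
  prop_eq (fun t => f (t + 1)) f ->
  prop_eq (fun t => f ((A%:R * t + B%:R) / D%:R))
          (fun t => f ((A%:R * t + (B %% D)%:R) / D%:R)).
Proof.
move=> A0 D0 [c c0 fc].
have DC : (D%:R : R[i]) != 0 by rewrite pnatr_eq0 -lt0n.
rewrite {1}(divn_eq B D); elim: (B %/ D)%N => [|n IH].
  by rewrite mul0n add0n; exact: prop_eq_refl.
apply: prop_eq_trans IH; exists c => //.
set b := (n * D + B %% D)%N.
have phi z : H z -> H (A%:R / D%:R * z + b%:R / D%:R).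
  rewrite /upper_half_plane /Im_gt /= => z0.
  have -> : A%:R / D%:R * z + b%:R / D%:R = (A%:R * z + b%:R) / D%:R by field.
  rewrite Im_divn raddfD /= Im_natM natr_complex /= addr0.
  by rewrite divr_gt0 ?mulr_gt0 ?ltr0n.
have AD : (A%:R / D%:R : R[i]) != 0 by rewrite mulf_neq0 ?invr_neq0 // pnatr_eq0 -lt0n.
have argE t : A%:R / D%:R * t + b%:R / D%:R = (A%:R * t + b%:R) / D%:R.
  by field.
move=> z /(mero_eq_affine AD phi fc); apply: filterS => t /=; rewrite argE => <-.
by congr f; rewrite mulSn -addnA natrD -/b; field.
Qed.

Lemma coprime_modnMl (a d x y : nat) : coprime a d ->
  a * x = a * y %[mod d] -> x = y %[mod d].
Proof.
move=> cad; wlog xy : x y / (x <= y)%N => [W|].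
  by move=> E; have [/W|/ltnW/W W'] := leqP x y; [apply|apply/esym/W'].
move=> /esym/eqP; rewrite eqn_mod_dvd ?leq_mul2l ?xy ?orbT // -mulnBr.
by rewrite Gauss_dvdr 1?coprime_sym // -eqn_mod_dvd // => /eqP.
Qed.

(** Modulo d' the index reduces to a b', which determines b' as a is prime to d'; then b d' modulo d
    d' determines b. The index map is thus injective between sets of the same size, hence
    bijective. *)
Lemma prod_residues (a d d' : nat) (G : nat -> R[i]) :
  (0 < d)%N -> (0 < d')%N -> coprime a d' ->
  \prod_(0 <= b' < d') \prod_(0 <= b < d) G ((a * b' + b * d') %% (d * d'))%N
  = \prod_(0 <= b < d * d') G b.
Proof.
move=> d0 d0' cad'; have dd0 : (0 < d * d')%N by rewrite muln_gt0 d0.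
under eq_bigr do rewrite big_mkord.
rewrite !big_mkord pair_bigA /=.
pose h (p : 'I_d' * 'I_d) : 'I_(d * d') :=
  Ordinal (ltn_pmod (a * p.1 + p.2 * d') dd0).
have hI : injective h.
  move=> [x y] [x' y'] [] E.
  have xx : x = x'.
    have /eqP := congr1 (modn^~ d') E; rewrite !modn_dvdm ?dvdn_mull //.
    rewrite ![(a * _ + _)%N]addnC !modnMDl => /eqP/(coprime_modnMl cad').
    by rewrite !modn_small // => /val_inj.
  move: E; rewrite -xx => /eqP; rewrite eqn_modDl => /eqP.
  rewrite -!muln_modl !modn_small // => /eqP; rewrite eqn_pmul2r // => /eqP/val_inj ->.
  by [].
rewrite (reindex h) //=; apply: onW_bij; apply: inj_card_bij => //.
by rewrite card_prod !card_ord mulnC.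
Qed.

(** The right-hand side is unchanged, up to the order of the factors, when [m] and [n] are
    exchanged; both orders of composition are compared with it. *)
Lemma hprod_hprod m n f : (0 < m)%N -> (0 < n)%N -> coprime m n ->
  prop_eq (fun t => f (t + 1)) f ->
  prop_eq (hprod m (hprod n f))
    (fun t => \prod_(d' <- divisors m) \prod_(d <- divisors n)
       \prod_(0 <= b < d * d')
         f (((n %/ d * (m %/ d'))%N%:R * t + b%:R) / (d * d')%N%:R)).
Proof.
move=> m0 n0 cmn fT; apply: prop_eq_prod => d' dm.
pose arg (d b b' : nat) t : R[i] :=
  ((n %/ d * (m %/ d'))%N%:R * t + (n %/ d * b' + b * d')%N%:R) / (d * d')%N%:R.
rewrite -dvdn_divisors // in dm.
have d0' := dvdn_gt0 m0 dm.
rewrite (_ : (fun t => _) = fun t => \prod_(d <- divisors n)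
   \prod_(0 <= b' < d') \prod_(0 <= b < d) f (arg d b b' t)); last first.
  (* Composition puts the product over b' outside that over d. The exchange allows a comparison for
     each pair d, d' separately. *)
  apply/funext => t; rewrite exchange_big /= big_seq [RHS]big_seq.
  apply: eq_bigr => d; rewrite -dvdn_divisors // => dn; have d0 := dvdn_gt0 n0 dn.
  apply: eq_bigr => b' _; apply: eq_bigr => b _; congr f.
  rewrite /arg natrD !natrM; field.
  by rewrite !pnatr_eq0 -!lt0n d0 d0'.
apply: prop_eq_prod => d; rewrite -dvdn_divisors // => dn.
have d0 := dvdn_gt0 n0 dn.
have A0 : (0 < n %/ d * (m %/ d'))%N.
  by rewrite muln_gt0 !divn_gt0 // (dvdn_leq n0 dn) (dvdn_leq m0 dm).
have D0 : (0 < d * d')%N by rewrite muln_gt0 d0.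
have cad : coprime (n %/ d) d'.
  apply: coprime_dvdl (dvdn_div dn) _; rewrite coprime_sym.
  exact: coprime_dvdl dm cmn.
(* Indexing the residues modulo d d' by pairs makes the two sides differ, factor by factor, only in
   a reduction modulo d d'. *)
rewrite (_ : (fun t => \prod_(0 <= b < d * d') _) = fun t =>
  \prod_(0 <= b' < d') \prod_(0 <= b < d) f
    (((n %/ d * (m %/ d'))%N%:R * t
      + ((n %/ d * b' + b * d') %% (d * d'))%N%:R) / (d * d')%N%:R)); last first.
  by apply/funext => t; rewrite -(prod_residues (fun b => f _) d0 d0' cad).
apply: prop_eq_prod => b' _; apply: prop_eq_prod => b _.
exact: prop_eq_periodic.
Qed.

Lemma hprodC m n f : (0 < m)%N -> (0 < n)%N -> coprime m n ->
  prop_eq (fun t => f (t + 1)) f ->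
  prop_eq (hprod m (hprod n f)) (hprod n (hprod m f)).
Proof.
move=> m0 n0 cmn fT; apply: prop_eq_trans (hprod_hprod m0 n0 cmn fT) _.
have cnm : coprime n m by rewrite coprime_sym.
apply: prop_eq_sym; apply: prop_eq_trans (hprod_hprod n0 m0 cnm fT) _.
rewrite (_ : (fun t => _) = fun t => \prod_(d' <- divisors m)
   \prod_(d <- divisors n) \prod_(0 <= b < d * d')
     f (((n %/ d * (m %/ d'))%N%:R * t + b%:R) / (d * d')%N%:R)).
  exact: prop_eq_refl.
apply/funext => t; rewrite exchange_big /=; apply: eq_bigr => d' _.
apply: eq_bigr => d _; rewrite (mulnC d' d).
by apply: eq_bigr => b _; rewrite (mulnC (m %/ d')%N).
Qed.

(** The translation by 1 belongs to [Gamma0 N] with automorphy factor 1, and its multiplier is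
    nonzero because it has modulus 1. *)
Lemma in_M_shift N (F : wfun R) : in_M N F -> prop_eq (fun t => fn F (t + 1)) (fn F).
Proof.
move=> [_ [chi chiP] _ _].
have T : Gamma0 N (mx2 1 1 0 1) by split; rewrite /SL2Z ?det_mx2 ?mxE ?dvdz0.
have [chi1 FT] := chiP _ T.
exists (chi (mx2 1 1 0 1)); first by rewrite -normr_gt0 chi1.
move=> z /FT; apply: filterS => t.
by rewrite /mobius /autfactor !mxE /= mul0r add0r !mul1r divr1 exp1rz mulr1.
Qed.

Lemma in_M_leading_coef N (F : wfun R) : in_M N F -> is_leading_coef (fn F) 1.
Proof.
move=> [_ _ _ [h [c [c0 Fc]]]]; split; first exact: oner_neq0.
by exists 1%N, h, (fun n => (c n)%:~R); rewrite c0.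
Qed.

(** A leading coefficient of [fn F] yields one of the Hecke product, so the normalizing factor is
    the inverse of a nonzero number and not the default 0. *)
Lemma hecke_fn l r (F : wfun R) c : prime l -> is_leading_coef (fn F) c ->
  exists2 k, k != 0 & forall t, fn (hecke l r F) t = k * hprod (l ^ r) (fn F) t.
Proof.
move=> pl Fc; have n0 : (0 < l ^ r)%N by rewrite expn_gt0 prime_gt0.
have [k k0 PE] := hecke_productE r (weight F) (fn F) pl.
have [d hd] := is_leading_coef_hprod n0 Fc.
have := is_leading_coefZ k0 hd; rewrite -(funext PE) => Pd.
have [d0 _] := Pd.
exists ((k * d)^-1 * k); first by rewrite mulf_neq0 ?invr_neq0.
by move=> t; rewrite /= (leading_coefE Pd) PE mulrA.
Qed.

(** The inner normalization changes the outer product by a nonzero constant only, which the outer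
    normalization removes. *)
Lemma hecke_hecke_fn l r l' r' (F : wfun R) c : prime l -> prime l' ->
  is_leading_coef (fn F) c ->
  mero_eq H (fn (hecke l' r' (hecke l r F)))
    (normalize (hprod (l' ^ r') (hprod (l ^ r) (fn F)))).
Proof.
move=> pl pl' Fc; have [k k0 FE] := hecke_fn r pl Fc.
apply: (@mero_eq_normalize _ (hecke_product l' r' _ (fn (hecke l r F)))).
have [k' k0' PE] := hecke_productE r' (weight (hecke l r F)) (fn (hecke l r F)) pl'.
have [k'' k0'' HE] := hprodZ (l' ^ r') (hprod (l ^ r) (fn F)) k0.
exists (k' * k''); first by rewrite mulf_neq0.
move=> z _; apply: nearW => t.
by rewrite PE (funext FE) HE mulrA.
Qed.

End HeckeProducts.

Theorem theorem3p5 (R : realType) (N p q r s : nat) (hN : (1 <= N)%N)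
  (hp : prime p) (hq : prime q) (hpq : p <> q)
  (hpN : ~~ (p %| N)%N) (hqN : ~~ (q %| N)%N)
  (hr : (1 <= r)%N) (hs : (1 <= s)%N)
  (F : wfun R) (hF : in_M N F) :
  wfun_eq (hecke q s (hecke p r F)) (hecke p r (hecke q s F)).
Proof.
(* Both weights are the weight of [F] times [sigma (p ^ r)] and [sigma (q ^ s)], in different
   orders. *)
split; first by rewrite /= mulrAC.
have Fc := in_M_leading_coef hF.
apply: mero_eq_trans (hecke_hecke_fn r s hp hq Fc) _.
apply: mero_eq_trans (mero_eq_sym (hecke_hecke_fn s r hq hp Fc)).
apply: mero_eq_normalize; apply: hprodC (in_M_shift hF).
- by rewrite expn_gt0 prime_gt0.
- by rewrite expn_gt0 prime_gt0.
- rewrite coprimeXl // coprimeXr // prime_coprime // dvdn_prime2 //.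
  by apply/eqP => qp; apply: hpq.
Qed.
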